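(* The logic $\mathbf{QCKL}^{-}$ is Kripke incomplete: there is no class $\mathcal{K}$ of (bimodal) Kripke frames such that $\mathbf{QCKL}^{-}$ equals the set of formulas valid in every frame of $\mathcal{K}$.
   Context: Language: countable set of variables, $\top,\bot,\land,\neg,\forall$, countably many predicate symbols of each arity, two modal operators $\mathsf{E},\mathsf{C}$. $\mathbf{QCKL}^{-}$ is the set of formulas derivable from: all classical predicate tautologies; $\Box(p\supset q)\supset(\Box p\supset\Box q)$ for $\Box\in\{\mathsf{E},\mathsf{C}\}$; $\mathsf{C}p\supset\mathsf{E}^np$ for each $n\in\omega$; modus ponens; uniform substitution; necessitation for $\mathsf{E}$ and $\mathsf{C}$; generalization; and the $\omega$-rule: from $\gamma\supset\mathsf{E}^n\phi$ for all $n\in\omega$ infer $\gamma\supset\mathsf{C}\phi$. A bimodal Kripke frame is $\langle C,\mathcal{N}_{\mathsf{E}},\mathcal{N}_{\mathsf{C}}\rangle$ with $C\neq\emptyset$ and $\mathcal{N}_{\mathsf{E}},\mathcal{N}_{\mathsf{C}}\colon C\to\mathcal{P}(\mathcal{P}(C))$ such that each $\mathcal{N}(c)$ is upward closed under inclusion and contains $\bigcap\mathcal{N}(c)$. A formula is valid in such a frame if for every nonempty constant domain $\mathcal{D}$, interpretation $\mathcal{I}$ ($P^{\mathcal{I}}(c)\subseteq\mathcal{D}^n$) and assignment $\mathcal{A}$ its valuation equals $C$, where valuation is: atomic via $\mathcal{I}$ pointwise, Boolean connectives set-theoretically, $\forall x\phi\mapsto\bigcap_{d\in\mathcal{D}}v_{[d/x]\mathcal{A}}(\phi)$,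 $\mathsf{E}\phi\mapsto\{c\mid v(\phi)\in\mathcal{N}_{\mathsf{E}}(c)\}$, $\mathsf{C}\phi\mapsto\{c\mid v(\phi)\in\mathcal{N}_{\mathsf{C}}(c)\}$. *)

(* Defs.v *)
From mathcomp Require Import all_boot.
From mathcomp Require Import classical_sets.

Set Implicit Arguments.
Unset Strict Implicit.
Unset Printing Implicit Defensive.

Local Open Scope classical_set_scope.

Definition var := nat.

Inductive modality := mE | mC.

(* [@Atom n P t] applies the [P]-th predicate symbol of arity [n] to [t]. *)
Inductive form :=
| Top
| Bot
| Atom n (P : nat) (t : n.-tuple var)
| And (phi psi : form)
| Neg (phi : form)
| All (x : var) (phi : form)
| Box (m : modality) (phi : form).

Definition Imp phi psi := Neg (And phi (Neg psi)).
Definition EE phi := Box mE phi.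
Definition CC phi := Box mC phi.

Definition pvar (i : nat) : form := @Atom 0 i [tuple].

Fixpoint fv (phi : form) : seq var :=
  match phi with
  | Top | Bot => [::]
  | Atom _ _ t => t
  | And phi psi => fv phi ++ fv psi
  | Neg phi => fv phi
  | All x phi => [seq y <- fv phi | y != x]
  | Box _ phi => fv phi
  end.

Definition upd (T : Type) (f : var -> T) (x : var) (a : T) : var -> T :=
  fun y => if y == x then a else f y.

(* [x] itself if it is not in [s], and otherwise a variable outside [s]. *)
Definition rebind (x : var) (s : seq var) : var :=
  if x \in s then (foldr maxn 0 s).+1 else x.

(* Capture-avoiding simultaneous substitution of variables for variables. *)
Fixpoint rename (s : var -> var) (phi : form) : form :=
  match phi with
  | Top => Top
  | Bot => Bot
  | Atom _ P t => Atom P (map_tuple s t)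
  | And phi psi => And (rename s phi) (rename s psi)
  | Neg phi => Neg (rename s phi)
  | All x psi =>
      let z := rebind x [seq s y | y <- fv (All x psi)] in
      All z (rename (upd s x z) psi)
  | Box m phi => Box m (rename s phi)
  end.

(* The formula [body] seen as an [n]-ary predicate of the variables [formals];
   [body] may have further free variables, which act as parameters. *)
Record abstraction (n : nat) := Abstraction {
  formals : n.-tuple var;
  body : form;
  formals_uniq : uniq formals }.

Definition instantiate n (a : abstraction n) (t : n.-tuple var) : form :=
  rename (fun y => if y \in formals a then nth y t (index y (formals a)) else y)
         (body a).

Definition psubstitution := forall n : nat, nat -> abstraction n.

(* The parameters [sigma] introduces for the predicate symbols of [phi]. *)
Fixpoint params (sigma : psubstitution) (phi : form) : seq var :=
  match phi with
  | Top | Bot => [::]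
  | Atom n P _ =>
      [seq y <- fv (body (sigma n P)) | y \notin formals (sigma n P)]
  | And phi psi => params sigma phi ++ params sigma psi
  | Neg phi | All _ phi | Box _ phi => params sigma phi
  end.

(* [s] records the renaming of the bound variables crossed so far, which is
   what keeps both the arguments of the atoms and the parameters of [sigma]
   from being captured. *)
Fixpoint psubst (sigma : psubstitution) (s : var -> var) (phi : form) : form :=
  match phi with
  | Top => Top
  | Bot => Bot
  | Atom n P t => instantiate (sigma n P) (map_tuple s t)
  | And phi psi => And (psubst sigma s phi) (psubst sigma s psi)
  | Neg phi => Neg (psubst sigma s phi)
  | All x psi =>
      let z := rebind x ([seq s y | y <- fv (All x psi)] ++ params sigma psi) in
      All z (psubst sigma (upd s x z) psi)
  | Box m phi => Box m (psubst sigma s phi)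
  end.

Definition usubst (sigma : psubstitution) (phi : form) : form :=
  psubst sigma id phi.

Fixpoint modal_free (phi : form) : bool :=
  match phi with
  | Top | Bot | Atom _ _ _ => true
  | And phi psi => modal_free phi && modal_free psi
  | Neg phi | All _ phi => modal_free phi
  | Box _ _ => false
  end.

(* Only meaningful on modal-free formulas; the value on [Box] is junk. *)
Fixpoint classical_sat (D : Type) (I : forall n, nat -> set (n.-tuple D))
    (A : var -> D) (phi : form) : Prop :=
  match phi with
  | Top => True
  | Bot => False
  | Atom n P t => I n P (map_tuple A t)
  | And phi psi => classical_sat I A phi /\ classical_sat I A psi
  | Neg phi => ~ classical_sat I A phi
  | All x phi => forall d : D, classical_sat I (upd A x d) phi
  | Box _ _ => False
  end.

Definition classical_tautology (phi : form) : Prop :=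
  modal_free phi /\
  forall (D : Type) (I : forall n, nat -> set (n.-tuple D)) (A : var -> D),
    inhabited D -> classical_sat I A phi.

Inductive QCKLm : set form :=
| QTaut phi : classical_tautology phi -> QCKLm phi
| QK m : QCKLm (Imp (Box m (Imp (pvar 0) (pvar 1)))
                    (Imp (Box m (pvar 0)) (Box m (pvar 1))))
| QCE n : QCKLm (Imp (CC (pvar 0)) (iter n EE (pvar 0)))
| QMP phi psi : QCKLm (Imp phi psi) -> QCKLm phi -> QCKLm psi
| QUS sigma phi : QCKLm phi -> QCKLm (usubst sigma phi)
| QNec m phi : QCKLm phi -> QCKLm (Box m phi)
| QGen x phi : QCKLm phi -> QCKLm (All x phi)
| QOmega gamma phi :
    (forall n, QCKLm (Imp gamma (iter n EE phi))) ->
    QCKLm (Imp gamma (CC phi)).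

Definition interpretation (W D : Type) :=
  forall n : nat, nat -> W -> set (n.-tuple D).

Fixpoint valuation (W D : Type) (N : modality -> W -> set (set W))
    (I : interpretation W D) (A : var -> D) (phi : form) : set W :=
  match phi with
  | Top => setT
  | Bot => set0
  | Atom n P t => [set c | I n P c (map_tuple A t)]
  | And phi psi => valuation N I A phi `&` valuation N I A psi
  | Neg phi => ~` valuation N I A phi
  | All x phi => \bigcap_(d in [set: D]) valuation N I (upd A x d) phi
  | Box m phi => [set c | N m c (valuation N I A phi)]
  end.

Record kripke_frame := KripkeFrame {
  world : Type;
  world_inhabited : inhabited world;
  nbhd : modality -> world -> set (set world);
  nbhd_upclosed : forall m c (X Y : set world),
    X `<=` Y -> nbhd m c X -> nbhd m c Y;
  nbhd_bigcap : forall m c, nbhd m c (\bigcap_(X in nbhd m c) X) }.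

Definition valid (F : kripke_frame) (phi : form) : Prop :=
  forall (D : Type) (I : interpretation (world F) D) (A : var -> D),
    inhabited D -> valuation (@nbhd F) I A phi = [set: world F].

(* Main.v *)
Require Import Defs.
From mathcomp Require Import all_boot.
From mathcomp Require Import classical_sets.
From mathcomp Require Import boolp filter.

(** Constant domains make the Barcan formula [forall x. E P(x) -> E forall x. P(x)]
    valid in every Kripke frame, since there the neighbourhoods of a world are
    closed under arbitrary intersections.  The logic is however sound for all
    neighbourhood frames whose E-neighbourhoods form a filter at each world and
    where C is read as the intersection of the iterates of E: the omega-rule is
    then sound pointwise.  Taking the cofinite filter on the natural numbers at
    every world refutes the Barcan formula, because a filter need only be closed
    under finite intersections. *)

Set Implicit Arguments.
Unset Strict Implicit.
Unset Printing Implicit Defensive.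

Local Open Scope classical_set_scope.

Lemma rebind_notin x (s : seq var) : rebind x s \notin s.
Proof.
rewrite /rebind; case: ifPn => // _; apply/negP => h.
suff: forall y, y \in s -> y <= foldr maxn 0 s by move/(_ _ h); rewrite ltnn.
elim: s {h} => //= a s IH y; rewrite inE => /orP[/eqP->|/IH h].
  exact: leq_maxl.
exact: leq_trans h (leq_maxr _ _).
Qed.

Lemma valuation_fv {W D : Type} (N : modality -> W -> set (set W))
    (I : interpretation W D) (phi : form) (A B : var -> D) :
  {in fv phi, A =1 B} -> valuation N I A phi = valuation N I B phi.
Proof.
elim: phi A B => //=.
- move=> n P t A B AB; suff -> : map_tuple A t = map_tuple B t by [].
  by apply: val_inj; apply/eq_in_map.
- move=> phi IH1 psi IH2 A B AB.
  by rewrite (IH1 A B) ?(IH2 A B) // => y yin; apply: AB;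
    rewrite mem_cat yin ?orbT.
- by move=> phi IH A B /IH ->.
- move=> x phi IH A B AB; apply: eq_bigcapr => d _; apply: IH => y yin.
  by rewrite /upd; case: eqP => // /eqP yx; apply: AB; rewrite mem_filter yx.
- by move=> m phi IH A B /IH ->.
Qed.

(** By freshness of [z], [s] sends no free variable of [phi] other than [x] to [z], so the update at
    [z] is seen only through [x]. The list [r] holds further names to avoid: none for [rename], the
    parameters for [psubst]. *)
Lemma upd_comp_rebind {D : Type} (A : var -> D) (s : var -> var) x d
    (phi : form) (r : seq var) :
  let z := rebind x ([seq s y | y <- fv (All x phi)] ++ r) in
  {in fv phi, upd A z d \o upd s x z =1 upd (A \o s) x d}.
Proof.
move=> z y yphi; rewrite /upd /=; have [_|yx] := eqVneq y x.
  by rewrite eqxx.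
case: eqP => // syz; have := rebind_notin x ([seq s y | y <- fv (All x phi)] ++ r).
rewrite -/z -syz mem_cat negb_or => /andP[/negP[]].
by apply: map_f; rewrite /= mem_filter yx.
Qed.

Lemma valuation_rename {W D : Type} (N : modality -> W -> set (set W))
    (I : interpretation W D) (phi : form) (s : var -> var) (A : var -> D) :
  valuation N I A (rename s phi) = valuation N I (A \o s) phi.
Proof.
elim: phi s A => //=.
- move=> n P t s A.
  suff -> : map_tuple A (map_tuple s t) = map_tuple (A \o s) t by [].
  by apply: val_inj; rewrite /= -map_comp.
- by move=> phi IH1 psi IH2 s A; rewrite IH1 IH2.
- by move=> phi IH s A; rewrite IH.
- move=> x phi IH s A; apply: eq_bigcapr => d _; rewrite IH.
  apply: valuation_fv.
  by have := @upd_comp_rebind D A s x d phi [::]; rewrite cats0.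
- by move=> m phi IH s A; rewrite IH.
Qed.

Definition assign {D : Type} {n} (v : n.-tuple var) (A : var -> D)
    (a : n.-tuple D) : var -> D :=
  fun y => if y \in v then nth (A y) a (index y v) else A y.

(** Substituting in the formula amounts to reinterpreting its predicate symbols. [A] fixes the
    values of the parameters once and for all, outside any quantifier of the formula. *)
Definition subst_interpretation {W D : Type} (N : modality -> W -> set (set W))
    (I : interpretation W D) (sigma : psubstitution) (A : var -> D) :
    interpretation W D :=
  fun n P c => [set a |
    valuation N I (assign (formals (sigma n P)) A a) (body (sigma n P)) c].

Lemma valuation_instantiate {W D : Type} (N : modality -> W -> set (set W))
    (I : interpretation W D) n (a : abstraction n) (t : n.-tuple var)
    (A : var -> D) :
  valuation N I A (instantiate a t) =
  valuation N I (assign (formals a) A (map_tuple A t)) (body a).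
Proof.
rewrite /instantiate valuation_rename; apply: valuation_fv => y _.
rewrite /assign /=; case: ifP => // yin; rewrite (nth_map y) //.
by rewrite size_tuple -[X in _ < X](size_tuple (formals a)) index_mem.
Qed.

(* [A0] stays fixed while [A] is updated under quantifiers; their agreement on
   the parameters is what the choice of bound variables in [psubst] preserves. *)
Lemma valuation_psubst {W D : Type} (N : modality -> W -> set (set W))
    (I : interpretation W D) (sigma : psubstitution) (A0 : var -> D)
    (phi : form) (s : var -> var) (A : var -> D) :
  {in params sigma phi, A =1 A0} ->
  valuation N I A (psubst sigma s phi) =
  valuation N (subst_interpretation N I sigma A0) (A \o s) phi.
Proof.
elim: phi s A => //=.
- move=> n P t s A AA0; rewrite valuation_instantiate.
  have -> : map_tuple A (map_tuple s t) = map_tuple (A \o s) t.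
    by apply: val_inj; rewrite /= -map_comp.
  rewrite /subst_interpretation; set a := map_tuple _ _.
  rewrite (@valuation_fv _ _ _ _ _ _ (assign (formals (sigma n P)) A0 a)) //.
  move=> y yin; rewrite /assign; case: ifPn => yf; last first.
    by apply: AA0; rewrite mem_filter yf.
  (* The two assignments differ here only in the default of [nth], and the index is in range. *)
  apply: set_nth_default.
  by rewrite size_tuple -[X in _ < X](size_tuple (formals (sigma n P))) index_mem.
- move=> phi IH1 psi IH2 s A AA0; rewrite IH1 ?IH2 // => y yin;
    by apply: AA0; rewrite mem_cat yin ?orbT.
- by move=> phi IH s A /IH ->.
- move=> x phi IH s A AA0; apply: eq_bigcapr => d _.
  rewrite IH; first exact/valuation_fv/upd_comp_rebind.
  move=> y yin; rewrite /upd; case: eqP => [yz|_]; last exact: AA0.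
  have := rebind_notin x ([seq s y | y <- fv (All x phi)] ++ params sigma phi).
  by rewrite -yz mem_cat yin orbT.
- by move=> m phi IH s A /IH ->.
Qed.

Lemma valuation_modal_free {W D : Type} (N : modality -> W -> set (set W))
    (I : interpretation W D) (phi : form) (A : var -> D) c :
  modal_free phi ->
  valuation N I A phi c <-> classical_sat (fun n P => I n P c) A phi.
Proof.
elim: phi A => //=.
- by move=> phi IH1 psi IH2 A /andP[/(IH1 A)[? ?] /(IH2 A)[? ?]]; split=> -[];
    split; auto.
- by move=> phi IH A /(IH A)[? ?]; split=> ? ?; auto.
- move=> x phi IH A mf; split=> [h d|h d _]; apply/IH => //; exact: h.
Qed.

Lemma valuation_Imp {W D : Type} (N : modality -> W -> set (set W))
    (I : interpretation W D) (A : var -> D) (phi psi : form) c :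
  valuation N I A (Imp phi psi) c <->
  (valuation N I A phi c -> valuation N I A psi c).
Proof.
split=> /= [h hphi|h [/h hpsi]]; last by [].
by apply: contrapT => hpsi; apply: h.
Qed.

Definition box {W : Type} (F : W -> set (set W)) (X : set W) : set W :=
  [set c | F c X].

Definition iterated_nbhd {W : Type} (F : W -> set (set W)) (m : modality) :
    W -> set (set W) :=
  match m with
  | mE => F
  | mC => fun c X => forall n, iter n (box F) X c
  end.

Lemma valuation_iter_EE {W D : Type} (F : W -> set (set W))
    (I : interpretation W D) (A : var -> D) n (phi : form) :
  valuation (iterated_nbhd F) I A (iter n EE phi) =
  iter n (box F) (valuation (iterated_nbhd F) I A phi).
Proof. by elim: n => //= n ->. Qed.

(** For [n = 0] this is the principal filter at [c]. In the successor step the filter laws at each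
    [c'] are carried through [F c] by its own filter laws. *)
Lemma iter_box_filter {W : Type} (F : W -> set (set W)) n c :
  (forall c, Filter (F c)) -> Filter (fun X => iter n (box F) X c).
Proof.
move=> fF; elim: n c => [|n IH] c /=.
  by split=> // X Y XY /XY.
split=> [|X Y hX hY|X Y XY].
- by apply: (filterS _ (@filterT _ _ (fF c))) => c' _; case: (IH c').
- by apply: (filterS _ (filterI hX hY)) => c' [hX' hY']; case: (IH c') => _ + _; apply.
- by apply: filterS => c'; case: (IH c') => _ _; apply.
Qed.

Lemma iterated_nbhd_filter {W : Type} (F : W -> set (set W)) m c :
  (forall c, Filter (F c)) -> Filter (iterated_nbhd F m c).
Proof.
move=> fF; case: m => //=; split=> [n|X Y hX hY n|X Y XY hX n];
  have [hT hI hS] := @iter_box_filter W F n c fF.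
- exact: hT.
- exact: hI.
- exact: hS (hX n).
Qed.

(** The interpretation is quantified after the derivation, so that the induction hypothesis for
    uniform substitution applies to [subst_interpretation]. *)
Lemma QCKLm_sound {W D : Type} (F : W -> set (set W)) (phi : form) :
  (forall c, Filter (F c)) -> inhabited D -> QCKLm phi ->
  forall (I : interpretation W D) (A : var -> D) c,
    valuation (iterated_nbhd F) I A phi c.
Proof.
move=> fF D0; elim=> {phi}.
- by move=> phi [mf taut] I A c; apply/valuation_modal_free => //; apply: taut.
- move=> m I A c; apply/valuation_Imp => hpq; apply/valuation_Imp => hp.
  have ? := @iterated_nbhd_filter W F m c fF.
  apply: filterS (filterI hpq hp) => c' [hpq' hp'].
  exact: (valuation_Imp (iterated_nbhd F) I A (pvar 0) (pvar 1) c').1.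
- by move=> n I A c; apply/valuation_Imp => h; rewrite valuation_iter_EE; apply: h.
- by move=> phi psi _ h1 _ h2 I A c; have /valuation_Imp := h1 I A c; apply.
- by move=> sigma phi _ IH I A c; rewrite /usubst (@valuation_psubst _ _ _ _ _ A).
- move=> m phi _ IH I A c.
  have ? := @iterated_nbhd_filter W F m c fF.
  by apply: (filterS _ filterT) => c' _; apply: IH.
- by move=> x phi _ IH I A c d _; apply: IH.
- move=> gamma phi _ IH I A c; apply/valuation_Imp => hg n.
  by rewrite -valuation_iter_EE; have /valuation_Imp := IH n I A c; apply.
Qed.

Definition barcan : form :=
  Imp (All 0 (EE (@Atom 1 0 [tuple 0]))) (EE (All 0 (@Atom 1 0 [tuple 0]))).

Lemma barcan_valid (K : kripke_frame) : valid K barcan.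
Proof.
move=> D I A _; apply/seteqP; split=> // c _; apply/valuation_Imp => h.
(* A point of the least neighbourhood of [c] lies in every neighbourhood, hence in the extension of
   the predicate at each [d]. *)
apply: nbhd_upclosed (nbhd_bigcap mE c) => c' hc' d _.
by apply: hc'; apply: h.
Qed.

Lemma barcan_not_QCKLm : ~ QCKLm barcan.
Proof.
move=> Qbarcan.
(* Each [d] satisfies the predicate at the cofinitely many worlds [w >= d], but at no world do all
   [d] satisfy it. *)
pose I : interpretation nat nat := fun n P w => [set a | head 0 a <= w].
have fF (c : nat) : Filter \oo by exact: filter_filter.
have /valuation_Imp := QCKLm_sound fF (inhabits 0) Qbarcan I id 0.
case=> [d _|N _ hN]; first by exists d.
(* World [N] belongs to the tail given by [hN], yet the element [N.+1] fails there. *)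
by have : N < N := hN N (leqnn N) N.+1 Logic.I; rewrite ltnn.
Qed.

Theorem theorem7p8 :
  ~ exists K : set kripke_frame,
      QCKLm = [set phi | forall F : kripke_frame, K F -> valid F phi].
Proof.
move=> [K QK]; apply: barcan_not_QCKLm; rewrite QK => F _.
exact: barcan_valid.
Qed.
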